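(* Let $F$ be an algebraically closed field, $m\ge 1$ an integer, $G=GL(m,F)$, let $\mathbf x=(\mathbf x^i_{j,l})_{i,j,l=1,\dots,m}$ be an $m\times m^2$ matrix of algebraically independent variables over $F$, and let $P(\mathbf x)$ be the $m\times m$ matrix over $F(\mathbf x)$ defined in the context (constructed from any admissible choice of an integer $k\ge 2$, of $m^k$ contractions and of $m$ columns). Then the field $F(\mathbf x)^G$ of $G$-invariant rational functions of structural constants is generated over $F$ by the system of entries of $P(\mathbf x)\,\mathbf x\,(P(\mathbf x)^{-1}\otimes P(\mathbf x)^{-1})$, that is, $$F(\mathbf x)^G=F\bigl(P(\mathbf x)\,\mathbf x\,(P(\mathbf x)^{-1}\otimes P(\mathbf x)^{-1})\bigr).$$
   Context: The group $G=GL(m,F)$ acts on $V=\mathrm{Mat}(m\times m^2;F)$ (matrices $A=(A^i_{j,l})$ of structural constants of $m$-dimensional algebras; rows indexed by $i$, columns by pairs $(j,l)$ in lexicographic order) by $\tau(g,A)=gA(g^{-1}\otimes g^{-1})$, where $\otimes$ is the Kronecker product. $F(\mathbf x)$ is the field of rational functions in the entries of $\mathbf x$, and $F(\mathbf x)^G=\{f\in F(\mathbf x): f(\tau(g,\mathbf x))=f(\mathbf x)\text{ for all } g\in G\}$. Construction of $P(\mathbf x)$. For an integer $k\ge1$, the tensor power $\mathbf x^{\otimes k}$ has $k$ upper and $2k$ lower indices. A contraction of $\mathbf x^{\otimes k}$ is the row vector of length $m^k$ obtained by contracting (setting equal and summing from $1$ to $m$) each of the $k$ upper indices with one of the $2k$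 lower indices, different upper indices being contracted with different lower indices; the remaining $k$ lower indices, taken in their natural order, index the $m^k$ entries in lexicographic order. For $k=1$, one of the contractions is $\mathbf{Tr}_1(\mathbf x)$, the row vector of length $m$ with $i$-th entry $\sum_{j=1}^m \mathbf x^j_{j,i}$. Choose $k\ge 2$ and $m^k$ contractions of $\mathbf x^{\otimes k}$ such that the $m^k\times m^k$ matrix $Q(\mathbf x)$ having these contractions as rows is nonsingular (that is, $\det Q(\mathbf x)$ is not the zero polynomial). Consider the $m\times m^k$ matrix $M(\mathbf x)=\bigl(\mathbf x\otimes \mathbf{Tr}_1(\mathbf x)^{\otimes (k-2)}\bigr)Q(\mathbf x)^{-1}$ over $F(\mathbf x)$, and choose $m$ of its columns such that the $m\times m$ submatrix formed by them is nonsingular over $F(\mathbf x)$. Denote this submatrix by $P(\mathbf x)^{-1}$, and its inverse by $P(\mathbf x)$. *)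

(* Defs.v *)
From mathcomp Require Import all_boot all_algebra.
From mathcomp Require Export mxtens mpoly.

Set Implicit Arguments.
Unset Strict Implicit.
Unset Printing Implicit Defensive.

Import GRing.Theory.
Local Open Scope ring_scope.
Local Open Scope quotient_scope.

(* Pairs of indices are encoded in lexicographic order by [mxtens_index], so
   that [tensmx] (infix [*t]) is the Kronecker product. *)

Section StructuralConstants.
Variables (K : fieldType) (m : nat).
Implicit Types (g : 'M[K]_m) (A : 'M[K]_(m, m * m)).

Definition tau g A : 'M[K]_(m, m * m) := g *m A *m (invmx g *t invmx g).

Definition Tr1 A : 'rV[K]_m := \row_i \sum_j A j (mxtens_index (j, i)).

(* The entry of the k-th tensor power of A with upper indices u and lower
   indices l; the lower indices of the a-th factor are numbered 2a and 2a+1. *)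
Definition tensor_power A k (u : 'I_k -> 'I_m) (l : 'I_(k * 2) -> 'I_m) : K :=
  \prod_(a < k) A (u a)
    (mxtens_index (l (mxtens_index (a, 0)), l (mxtens_index (a, 1)))).

(* The rank of a word in the lexicographic order: its value in base m, first
   letter most significant. *)
Definition lex_rank (w : seq 'I_m) : nat :=
  foldl (fun n (d : 'I_m) => n * m + d)%N 0%N w.

(* Upper index number a is contracted with lower index number c a.  The sum is
   over all values l of the lower indices for which the non-contracted ones,
   read in their natural order, form the multi-index of rank J. *)
Definition contraction A k (c : 'I_k -> 'I_(k * 2)) : 'rV[K]_(m ^ k) :=
  \row_J \sum_(l : {ffun 'I_(k * 2) -> 'I_m} |
      lex_rank [seq l p | p <- enum 'I_(k * 2) & p \notin codom c] == J)
    tensor_power A (fun a => l (c a)) l.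

Definition Qmx A k (c : 'I_(m ^ k) -> 'I_k -> 'I_(k * 2)) : 'M[K]_(m ^ k) :=
  \matrix_r contraction A (c r).

Lemma Mmx_nrows k : (m * 1 ^ (k - 2) = m)%N.
Proof. by rewrite exp1n muln1. Qed.

Lemma Mmx_ncols k : (1 < k)%N -> (m * m * m ^ (k - 2) = m ^ k)%N.
Proof. by move=> k_gt1; rewrite mulnn -expnD subnKC. Qed.

Definition Mmx A k (k_gt1 : (1 < k)%N) (c : 'I_(m ^ k) -> 'I_k -> 'I_(k * 2)) :
    'M[K]_(m, m ^ k) :=
  castmx (Mmx_nrows k, Mmx_ncols k_gt1) (A *t (Tr1 A) ^t (k - 2))
    *m invmx (Qmx A c).

End StructuralConstants.

Notation ratfun F m := {fraction {mpoly F[m * (m * m)]}}.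

Section RationalFunctions.
Variables (F : fieldType) (m : nat).

Local Notation ratfun := (ratfun F m).

Definition ratC (a : F) : ratfun := FracField.tofrac a%:MP.

Definition genx : 'M[ratfun]_(m, m * m) :=
  \matrix_(i, J) FracField.tofrac 'X_(mxvec_index i J).

(* f(B), computed from a representation of f as a quotient of polynomials; the
   result does not depend on it as long as its denominator does not vanish at
   B, which always holds for B = tau g x with g in GL(m, F). *)
Definition ratfun_subst (f : ratfun) (B : 'M[ratfun]_(m, m * m)) : ratfun :=
  mmap ratC (mxvec B 0) \n_(repr f) / mmap ratC (mxvec B 0) \d_(repr f).

Definition GL_invariant (f : ratfun) : Prop :=
  forall g : 'M[F]_m, g \in unitmx ->
    ratfun_subst f (tau (map_mx ratC g) genx) = f.

Inductive subfield_gen (S : ratfun -> Prop) : ratfun -> Prop :=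
| subfield_gen_const a : subfield_gen S (ratC a)
| subfield_gen_mem f : S f -> subfield_gen S f
| subfield_gen_sub f g :
    subfield_gen S f -> subfield_gen S g -> subfield_gen S (f - g)
| subfield_gen_mul f g :
    subfield_gen S f -> subfield_gen S g -> subfield_gen S (f * g)
| subfield_gen_inv f : subfield_gen S f -> subfield_gen S f^-1.

End RationalFunctions.

(* Main.v *)
From HB Require Import structures.
Require Import Defs.
From mathcomp Require Import all_boot all_algebra.
Local Open Scope ring_scope.

(** Let K = F(x).  A change of basis g multiplies Pinv(x) by g on the left:
    every contraction of A is multiplied on the right by the k-th tensor power
    of g^-1 when A is replaced by tau g A [contraction_basechange], so Q(x) is
    too; Tr1 is multiplied by g^-1 [Tr1_basechange]; and in
    (x *t Tr1 ^t (k - 2)) *m Q^-1 the tensor powers cancel, leaving only the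
    factor g of the upper index [Mmx_tau].  Hence y = tau P x, with P the
    inverse of Pinv(x), takes the same value at x and at tau g x
    [normal_form_tau].  Substituting tau g x for x extends to an endomorphism
    of the field K that fixes F [subst_rmorph]; the elements that it fixes form
    a subfield, which contains F and the entries of y, hence also the subfield
    that these generate.

    Conversely let f = n / d be invariant.  The identity
    n(tau g x) d(x) = n(x) d(tau g x), valid for all g in GL(m, F), is up to a
    power of det g polynomial in the entries of g, and F is infinite; so it
    remains true for g in GL(m, K) [tau_density].  For g = P it reads
    n(y) d(x) = n(x) d(y), which would finish the proof if d(y) were nonzero.
    In general d may vanish on the section {y}, and the section is first moved
    off the zero set of d by a constant matrix h: if d(tau h y) were zero for
    all h in GL(m, F), it would be zero for all h in GL(m, K), in particular
    for h = P^-1, where it is d(x).  With a good h,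
    f = n(tau h y) / d(tau h y), a rational expression in the entries of y
    with coefficients in F [invariant_in_subfield_gen]. *)

Set Implicit Arguments.
Unset Strict Implicit.
Unset Printing Implicit Defensive.

Import GRing.Theory.
Local Open Scope quotient_scope.

(** * Words in lexicographic order and entries of tensor powers *)

Section Words.
Variable m : nat.
Implicit Types w : seq 'I_m.

Lemma lex_rank_cons (p : 'I_m) w :
  lex_rank (p :: w) = (p * m ^ size w + lex_rank w)%N.
Proof.
suff foldE n : foldl (fun n (d : 'I_m) => n * m + d)%N n w
    = (n * m ^ size w + lex_rank w)%N.
  by rewrite [LHS]foldE mul0n add0n.
rewrite /lex_rank; elim: w n => [|d w IHw] n /=; first by rewrite muln1 addn0.
by rewrite IHw [in RHS]IHw mul0n add0n mulnDl expnS mulnA addnA.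
Qed.

Lemma lex_rank_lt w : (lex_rank w < m ^ size w)%N.
Proof.
elim: w => [|p w IHw] //; rewrite lex_rank_cons /= expnS.
apply: (@leq_trans (p.+1 * m ^ size w)).
  by rewrite mulSn addnC ltn_add2r.
by rewrite leq_mul2r ltn_ord orbT.
Qed.

Lemma lex_rank_inj w w' :
  size w = size w' -> lex_rank w = lex_rank w' -> w = w'.
Proof.
elim: w w' => [|p w IHw] [|p' w'] //= [eq_sz].
rewrite !lex_rank_cons eq_sz => /eqP; rewrite eq_addl_mul; last 2 first.
- by rewrite -eq_sz lex_rank_lt.
- by rewrite lex_rank_lt.
by case/eqP => /val_inj -> /(IHw _ eq_sz) ->.
Qed.

Lemma lex_index_proof k (w : k.-tuple 'I_m) : (lex_rank w < m ^ k)%N.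
Proof. by rewrite -{2}(size_tuple w) lex_rank_lt. Qed.

Definition lex_index k (w : k.-tuple 'I_m) : 'I_(m ^ k) :=
  Ordinal (lex_index_proof w).

Lemma lex_index_inj k : injective (@lex_index k).
Proof.
move=> w w' /(congr1 val) /= /lex_rank_inj eq_w.
by apply/val_inj/eq_w; rewrite !size_tuple.
Qed.

Lemma lex_index_bij k : bijective (@lex_index k).
Proof.
by apply: inj_card_bij; [exact: lex_index_inj | rewrite card_tuple !card_ord].
Qed.

Lemma lex_indexP k (J : 'I_(m ^ k)) : exists w : k.-tuple 'I_m, J = lex_index w.
Proof. by have [f _ fK] := lex_index_bij k; exists (f J); rewrite fK. Qed.

Lemma lex_index_cons k p (w : k.+1.-tuple 'I_m) :
  lex_index [tuple of p :: w] = mxtens_index (p, lex_index w) :> 'I_(m ^ k.+2).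
Proof. by apply: val_inj; rewrite /= lex_rank_cons size_tuple. Qed.

End Words.

Lemma mxtens_index_bij m n : bijective (@mxtens_index m n).
Proof.
exists (@mxtens_unindex m n); first exact: mxtens_indexK.
exact: mxtens_unindexK.
Qed.

Section TensorPowers.
Variable R : comPzRingType.

Lemma tensmx11 m n : (1%:M *t 1%:M : 'M[R]_(m * n)) = 1%:M.
Proof.
apply/matrixP => i j; rewrite !mxE -natrM mulnb.
by rewrite -(can_eq (@mxtens_unindexK m n)) xpair_eqE.
Qed.

Lemma ntensmx_mul m n p (A : 'M[R]_(m, n)) (B : 'M_(n, p)) k :
  (A *m B) ^t k = A ^t k *m B ^t k.
Proof.
case: k => [|k]; first by rewrite [RHS]mul1mx.
by elim: k => // k IHk; rewrite !ntensmxSS IHk tensmx_mul.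
Qed.

Lemma ntensmx11 m k : (1%:M : 'M[R]_m) ^t k = 1%:M.
Proof.
case: k => // k; elim: k => // k IHk.
by rewrite ntensmxSS IHk tensmx11.
Qed.

Lemma ntensmxE m n k (A : 'M[R]_(m, n)) (u : k.-tuple 'I_m)
    (v : k.-tuple 'I_n) :
  (A ^t k) (lex_index u) (lex_index v) = \prod_(a < k) A (tnth u a) (tnth v a).
Proof.
case: k => [|k] in u v *.
  by rewrite big_ord0 (tuple0 u) (tuple0 v) !mxE.
elim: k => [|k IHk] in u v *.
  rewrite big_ord1 ntensmx1; congr (A _ _); apply: val_inj.
    by case/tupleP: u => p u; rewrite (tuple0 u).
  by case/tupleP: v => p v; rewrite (tuple0 v).
case/tupleP: u => p u; case/tupleP: v => q v.
rewrite !lex_index_cons ntensmxSS tensmxE IHk [RHS]big_ord_recl.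
by congr (_ * _); apply: eq_bigr => a _; rewrite !tnthS.
Qed.

(** The tensor power peels off factors on the left, whereas the first block of
    the matrix that defines [Mmx] associates to the left: both have the same
    entries once rows and columns are read as words of length [k]. *)
Lemma castmx_tens2_ntens m n (h : 'M[R]_m) k
    (e1 e2 : (m * m * m ^ n)%N = (m ^ k)%N) : k = n.+2 ->
  castmx (e1, e2) ((h *t h) *t h ^t n) = h ^t k.
Proof.
move=> def_k; subst k; apply/matrixP => I J.
have split_index e (p q : 'I_m) (w : n.-tuple 'I_m) :
    cast_ord (esym e) (lex_index [tuple of p :: [tuple of q :: w]])
    = mxtens_index (mxtens_index (p, q), lex_index w).
  apply: val_inj => /=; rewrite !lex_rank_cons /= -[size w]/(size (val w)).
  by rewrite (size_tuple w) expnS mulnDl mulnA addnA.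
have [u ->] := lex_indexP I; have [v ->] := lex_indexP J.
case/tupleP: u => p u; case/tupleP: u => q u.
case/tupleP: v => p' v; case/tupleP: v => q' v.
rewrite castmxE !split_index !tensmxE !ntensmxE [RHS]big_ord_recl.
rewrite [X in _ = _ * X]big_ord_recl mulrA; congr (_ * _).
by apply: eq_bigr => a _; rewrite !tnthS.
Qed.

End TensorPowers.

(** * Contractions under a change of basis *)

Lemma big_ord_pairs (R : Type) (idx : R) (op : Monoid.com_law idx) k
    (F : 'I_(k * 2) -> R) :
  \big[op/idx]_b F b
  = \big[op/idx]_(a < k) op (F (mxtens_index (a, 0))) (F (mxtens_index (a, 1))).
Proof.
rewrite (reindex (@mxtens_index k 2)); last exact/onW_bij/mxtens_index_bij.
rewrite (eq_bigr (fun ae => F (mxtens_index (ae.1, ae.2)))) => [|[a e] _] //.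
rewrite -(pair_bigA _ (fun a e => F (mxtens_index (a, e)))).
apply: eq_bigr => a _; rewrite !big_ord_recl big_ord0 Monoid.mulm1.
by congr (op _ (F (mxtens_index (_, _)))); apply: val_inj.
Qed.

(** The contraction arguments need this triple sum over one upper and two
    lower indices packed as a single sum, so that a product of such entries
    distributes. *)
Lemma basechangeE (R : comPzRingType) m (g h : 'M[R]_m) (A : 'M_(m, m * m))
    i p q :
  (g *m A *m (h *t h)) i (mxtens_index (p, q))
  = \sum_(t : 'I_m * ('I_m * 'I_m))
      g i t.1 * A t.1 (mxtens_index t.2) * (h t.2.1 p * h t.2.2 q).
Proof.
rewrite -(pair_bigA _ (fun j pq =>
  g i j * A j (mxtens_index pq) * (h pq.1 p * h pq.2 q))) exchange_big mxE /=.
rewrite (reindex (@mxtens_index m m)); last exact/onW_bij/mxtens_index_bij.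
by apply: eq_bigr => -[p' q'] _; rewrite mxE tensmxE mulr_suml.
Qed.

Section Contractions.
Variables (m k : nat) (c : 'I_k -> 'I_(k * 2)).
Hypothesis c_inj : injective c.

Definition free_indices := [seq p <- enum 'I_(k * 2) | p \notin codom c].

Lemma size_free_indices : size free_indices == k.
Proof.
have card_free : #|[predC mem (codom c)]| = k.
  have := cardC (mem (codom c)); rewrite card_codom // !card_ord => eq_k.
  by apply: (@addnI k); rewrite eq_k muln2 addnn.
rewrite size_filter -sum1_count big_enum_cond sum1_card -[X in _ == X]card_free.
by apply/eqP/eq_card => p; rewrite !inE.
Qed.

Definition free_tuple : k.-tuple 'I_(k * 2) := Tuple size_free_indices.

(** Lower indices of the k-th tensor power come in two kinds: those bound to
    an upper index, and the free ones; there are [k] of each. *)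
Definition index_slot (s : 'I_k + 'I_k) : 'I_(k * 2) :=
  match s with inl a => c a | inr r => tnth free_tuple r end.

Lemma index_slot_bij : bijective index_slot.
Proof.
have uniq_free : uniq free_tuple by rewrite filter_uniq ?enum_uniq.
have free_notin r : tnth free_tuple r \notin codom c.
  by have := mem_tnth r free_tuple; rewrite mem_filter => /andP[].
apply: inj_card_bij; last by rewrite card_sum !card_ord muln2 addnn.
case=> [a|r] [a'|r'] /= eq_slot.
- by rewrite (c_inj eq_slot).
- by have := free_notin r'; rewrite -eq_slot codom_f.
- by have := free_notin r; rewrite eq_slot codom_f.
by congr inr; apply: (tuple_uniqP _ uniq_free).
Qed.

Lemma big_index_slot (R : Type) (idx : R) (op : Monoid.com_law idx) F :
  \big[op/idx]_b F b
  = op (\big[op/idx]_a F (c a)) (\big[op/idx]_r F (tnth free_tuple r)).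
Proof.
rewrite (reindex index_slot) /=; last exact/onW_bij/index_slot_bij.
by rewrite big_sumType.
Qed.

(** Fixing the free lower indices leaves the bound ones to vary independently,
    which turns the constrained sum into a product of sums. *)
Lemma sum_free_fixed (R : comPzSemiRingType) (w : k.-tuple 'I_m)
    (H : 'I_k -> 'I_m -> R) :
  \sum_(l : {ffun 'I_(k * 2) -> 'I_m} | map_tuple l free_tuple == w)
      \prod_a H a (l (c a))
  = \prod_a \sum_j H a j.
Proof.
have [inv_slot slotK inv_slotK] := index_slot_bij.
pose glue (u : {ffun 'I_k -> 'I_m}) : {ffun 'I_(k * 2) -> 'I_m} :=
  [ffun b => match inv_slot b with inl a => u a | inr r => tnth w r end].
have glue_c u a : glue u (c a) = u a by rewrite ffunE (slotK (inl a)).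
have glue_free u r : glue u (tnth free_tuple r) = tnth w r.
  by rewrite ffunE (slotK (inr r)).
rewrite bigA_distr_bigA (reindex_onto glue (fun l => [ffun a => l (c a)])) /=.
  apply: eq_big => [u|u _]; last by apply: eq_bigr => a _; rewrite glue_c.
  apply/andP; split; apply/eqP.
    by apply: eq_from_tnth => r; rewrite tnth_map glue_free.
  by apply/ffunP => a; rewrite ffunE glue_c.
move=> l /eqP def_w; apply/ffunP => b; rewrite ffunE.
case: (inv_slot b) (inv_slotK b) => /= [a|r] <-; first by rewrite ffunE.
by rewrite -def_w tnth_map.
Qed.

Variable K : fieldType.
Implicit Types (g h : 'M[K]_m) (A : 'M[K]_(m, m * m)).

Lemma contractionE A (w : k.-tuple 'I_m) :
  contraction A c 0 (lex_index w)
  = \sum_(l : {ffun 'I_(k * 2) -> 'I_m} | map_tuple l free_tuple == w)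
      tensor_power A (fun a => l (c a)) l.
Proof.
rewrite mxE; apply: eq_bigl => l.
by rewrite -(inj_eq (@lex_index_inj m k)) -val_eqE.
Qed.

(** Multilinearity of the tensor power: the sums over the new upper indices [v]
    and the new lower indices [l'] are collected in front of the product. *)
Lemma tensor_power_basechange g h A (u : 'I_k -> 'I_m)
    (l : 'I_(k * 2) -> 'I_m) :
  tensor_power (g *m A *m (h *t h)) u l
  = \sum_(v : {ffun 'I_k -> 'I_m}) \sum_(l' : {ffun 'I_(k * 2) -> 'I_m})
      (\prod_a g (u a) (v a)) * tensor_power A v l' * \prod_b h (l' b) (l b).
Proof.
pose G a (t : 'I_m * ('I_m * 'I_m)) :=
  g (u a) t.1 * A t.1 (mxtens_index t.2)
  * (h t.2.1 (l (mxtens_index (a, 0))) * h t.2.2 (l (mxtens_index (a, 1)))).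
transitivity (\prod_a \sum_t G a t).
  by apply: eq_bigr => a _; rewrite basechangeE.
rewrite bigA_distr_bigA pair_bigA /=.
(* [merge] splits a family of triples into upper and lower indices; 2a and
   2a+1 are the two lower slots of factor a. *)
pose lower (f : {ffun 'I_k -> 'I_m * ('I_m * 'I_m)}) (ae : 'I_k * 'I_2) :=
  if ae.2 == 0 then (f ae.1).2.1 else (f ae.1).2.2.
pose merge (f : {ffun 'I_k -> 'I_m * ('I_m * 'I_m)}) :
    {ffun 'I_k -> 'I_m} * {ffun 'I_(k * 2) -> 'I_m} :=
  ([ffun a => (f a).1],
   [ffun b => lower f (mxtens_unindex b)]).
rewrite [RHS](reindex merge); last first.
  exists (fun vl : {ffun 'I_k -> 'I_m} * {ffun 'I_(k * 2) -> 'I_m} =>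
      [ffun a => (vl.1 a, (vl.2 (mxtens_index (a, 0)),
                                         vl.2 (mxtens_index (a, 1))))]).
    move=> f _; apply/ffunP => a; rewrite !ffunE !mxtens_indexK /=.
    by rewrite -!surjective_pairing.
  move=> [v l'] _; congr (_, _); apply/ffunP => b; rewrite !ffunE //.
  case: (mxtens_indexP b) => a e; rewrite mxtens_indexK /lower /= ffunE /=.
  case: (altP (e =P 0)) => [-> //|]; case: e => -[|[|//]] //= lt_e2 _.
  by congr (l' (mxtens_index (_, _))); apply: val_inj.
apply: eq_bigr => f _; rewrite big_ord_pairs -!big_split /=.
apply: eq_bigr => a _.
by rewrite !ffunE !mxtens_indexK /lower /= -surjective_pairing.
Qed.

(** At each contracted pair the factor [g] of the upper index meets a factor [h]
    of the lower index, and they cancel; only the [h] at the [k] free lower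
    indices remain. *)
Lemma contraction_basechange g h A : h *m g = 1%:M ->
  contraction (g *m A *m (h *t h)) c = contraction A c *m h ^t k.
Proof.
move=> hg1; apply/rowP => J; have [w ->] := lex_indexP J.
pose hfree (l' : {ffun 'I_(k * 2) -> 'I_m}) :=
  \prod_r h (l' (tnth free_tuple r)) (tnth w r).
(* Both sides equal the sum defining the contraction of A, with each term l'
   weighted by the factors [h] that survive at its free indices. *)
transitivity (\sum_(l' : {ffun 'I_(k * 2) -> 'I_m})
    tensor_power A (fun a => l' (c a)) l' * hfree l').
  rewrite contractionE.
  under eq_bigr do rewrite tensor_power_basechange.
  rewrite exchange_big /=; under eq_bigr do rewrite exchange_big /=.
  rewrite exchange_big /=; apply: eq_bigr => l' _.
  transitivity (\sum_(v : {ffun 'I_k -> 'I_m})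
      tensor_power A v l' * hfree l' * \prod_a (l' (c a) == v a)%:R).
    apply: eq_bigr => v _.
    transitivity (\sum_(l : {ffun 'I_(k * 2) -> 'I_m}
          | map_tuple l free_tuple == w)
        tensor_power A v l' * hfree l'
        * \prod_a (h (l' (c a)) (l (c a)) * g (l (c a)) (v a))).
      apply: eq_bigr => l /eqP def_w; rewrite big_index_slot /= big_split /=.
      have -> : \prod_r h (l' (tnth free_tuple r)) (l (tnth free_tuple r))
          = hfree l'.
        by apply: eq_bigr => r _; rewrite -def_w tnth_map.
      by rewrite (AC (2*2) ((2*4)*(3*1))).
    rewrite -mulr_sumr.
    rewrite (sum_free_fixed w (fun a j => h (l' (c a)) j * g j (v a))).
    congr (_ * _); apply: eq_bigr => a _.
    by have /matrixP/(_ (l' (c a)) (v a)) := hg1; rewrite !mxE.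
  rewrite (bigD1 [ffun a => l' (c a)]) //= [X in _ + X]big1 => [|v v_neq].
    rewrite addr0 [X in _ * X]big1 => [|a _]; last by rewrite ffunE eqxx.
    rewrite mulr1; congr (_ * _); apply: eq_bigr => a _.
    by rewrite ffunE.
  have /existsP[a ne_a] : [exists a, l' (c a) != v a].
    rewrite -negb_forall; apply: contra v_neq => /forallP eq_v.
    by apply/eqP/ffunP => a; rewrite ffunE (eqP (eq_v a)).
  by rewrite [X in _ * X](bigD1 a) //= (negPf ne_a) mul0r mulr0.
rewrite mxE (reindex (@lex_index m k)); last exact/onW_bij/lex_index_bij.
rewrite (partition_big (fun l' : {ffun 'I_(k * 2) -> 'I_m} =>
    map_tuple l' free_tuple) predT) //=.
apply: eq_bigr => w' _; rewrite contractionE ntensmxE mulr_suml.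
apply: eq_bigr => l' /eqP <-; congr (_ * _).
by apply: eq_bigr => r _; rewrite tnth_map.
Qed.

End Contractions.

Lemma castmx_mul3 (R : pzRingType) m n m' n' (e1 : m = m') (e2 : n = n')
    (A : 'M[R]_m) (B : 'M_(m, n)) (C : 'M_n) :
  castmx (e1, e2) (A *m B *m C)
  = castmx (e1, e1) A *m castmx (e1, e2) B *m castmx (e2, e2) C.
Proof. by case: m' / e1; case: n' / e2; rewrite !castmx_id. Qed.

(** The Kronecker product that defines [Mmx] has m * 1 ^ (k - 2) rows, since
    [Tr1] is a row vector; the unit factor does not affect the action of [g]. *)
Lemma castmx_tens1 (R : pzRingType) m n (e : (m * 1 ^ n)%N = m) (g : 'M[R]_m) :
  castmx (e, e) (g *t (1%:M : 'M_(1 ^ n))) = g.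
Proof.
apply/matrixP => i j; rewrite castmxE.
have cast_index (i' : 'I_m) (o : 'I_(1 ^ n)) :
    cast_ord (esym e) i' = mxtens_index (i', o).
  apply: val_inj; move: o => /=; rewrite exp1n => o.
  by rewrite muln1 (ord1 o) addn0.
have o : 'I_(1 ^ n) by rewrite exp1n; exact: ord0.
by rewrite !(cast_index _ o) tensmxE mxE eqxx mulr1.
Qed.

Section Equivariance.
Variables (K : fieldType) (m : nat).
Implicit Types (g h : 'M[K]_m) (A : 'M[K]_(m, m * m)).

(** The same cancellation for k = 1, done separately because [Tr1] is not
    defined as a [contraction]. *)
Lemma Tr1_basechange g h A : h *m g = 1%:M ->
  Tr1 (g *m A *m (h *t h)) = Tr1 A *m h.
Proof.
move=> hg1; apply/rowP => i; rewrite !mxE.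
under eq_bigr do rewrite basechangeE.
pose G a p q := \sum_j g j a * A a (mxtens_index (p, q)) * (h p j * h q i).
rewrite exchange_big /=.
transitivity (\sum_a \sum_(pq : 'I_m * 'I_m) G a pq.1 pq.2).
  by rewrite [RHS]pair_bigA /=; apply: eq_bigr => -[a [p q]].
transitivity (\sum_a \sum_q \sum_p G a p q).
  by apply: eq_bigr => a _; rewrite [RHS]exchange_big pair_bigA.
rewrite exchange_big /=; apply: eq_bigr => q _; rewrite mxE mulr_suml.
apply: eq_bigr => a _.
have sumE p : G a p q = A a (mxtens_index (p, q)) * h q i * (p == a)%:R.
  have /matrixP/(_ p a) := hg1; rewrite !mxE => <-; rewrite mulr_sumr.
  by apply: eq_bigr => j _; rewrite (AC (2*2) ((2*4)*(3*1))).
rewrite (bigD1 a) //= sumE eqxx mulr1 big1 ?addr0 // => p p_neq.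
by rewrite sumE (negPf p_neq) mulr0.
Qed.

Lemma tau_tau g1 g2 A : g1 \in unitmx -> g2 \in unitmx ->
  tau g1 (tau g2 A) = tau (g1 *m g2) A.
Proof.
move=> U1 U2; rewrite /tau.
have -> : invmx (g1 *m g2) = invmx g2 *m invmx g1.
  have U12 : g1 *m g2 \in unitmx by rewrite unitmx_mul U1.
  apply: (can_inj (mulKmx U12)).
  by rewrite mulmxV // mulmxA mulmxK // mulmxV.
by rewrite -tensmx_mul !mulmxA.
Qed.

Lemma tau1 A : tau 1%:M A = A.
Proof. by rewrite /tau invmx1 tensmx11 mulmx1 mul1mx. Qed.

Variables (k : nat) (k_gt1 : (1 < k)%N) (c : 'I_(m ^ k) -> 'I_k -> 'I_(k * 2)).
Hypothesis c_inj : forall r, injective (c r).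

Lemma Qmx_tau g A : g \in unitmx ->
  Qmx (tau g A) c = Qmx A c *m (invmx g) ^t k.
Proof.
move=> gU; apply/row_matrixP => r; rewrite row_mul !rowK.
by apply: contraction_basechange => //; apply: mulVmx.
Qed.

(** The tensor power of g^-1 coming from the numerator cancels against the
    inverse of the one coming from [Qmx]. *)
Lemma Mmx_tau g A : g \in unitmx -> Qmx A c \in unitmx ->
  Mmx (tau g A) k_gt1 c = g *m Mmx A k_gt1 c.
Proof.
move=> gU QU; set h := invmx g; have hg : h *m g = 1%:M by apply: mulVmx.
have hk : h ^t k *m g ^t k = 1%:M by rewrite -ntensmx_mul hg ntensmx11.
have hkU : h ^t k \in unitmx by case/mulmx1_unit: hk.
have inv_Q : invmx (Qmx A c *m h ^t k) = g ^t k *m invmx (Qmx A c).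
  have QhU : Qmx A c *m h ^t k \in unitmx by rewrite unitmx_mul QU.
  apply: (can_inj (mulKmx QhU)); rewrite mulmxV // -mulmxA [X in _ *m X]mulmxA.
  by rewrite hk mul1mx mulmxV.
rewrite /Mmx Qmx_tau // inv_Q [RHS]mulmxA !mulmxA; congr (_ *m _).
rewrite /tau -/h Tr1_basechange // ntensmx_mul -tensmx_mul.
have -> : (g *m A) *t Tr1 A ^t (k - 2)
    = (g *t 1%:M) *m (A *t Tr1 A ^t (k - 2)) by rewrite tensmx_mul mul1mx.
rewrite castmx_mul3 castmx_tens1 castmx_tens2_ntens //.
  by rewrite -!mulmxA hk mulmx1.
by rewrite -addn2 subnK.
Qed.

Variable s : 'I_m -> 'I_(m ^ k).

(** The frame attached to A is the matrix Pinv(A) of the construction; under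
    [tau] it moves like the matrix of a basis. *)
Definition frame A := colsub s (Mmx A k_gt1 c).

Definition normal_form A :=
  invmx (frame A) *m A *m (frame A *t frame A).

Lemma normal_formE A : frame A \in unitmx ->
  normal_form A = tau (invmx (frame A)) A.
Proof. by move=> PU; rewrite /tau invmxK. Qed.

Lemma frame_tau g A : g \in unitmx -> Qmx A c \in unitmx ->
  frame (tau g A) = g *m frame A.
Proof.
by move=> gU QU; rewrite /frame Mmx_tau // mulmx_colsub.
Qed.

(** Moving A by g moves its frame by g, and the two effects compensate: in
    terms of frames, (g frame)^-1 g = frame^-1. *)
Lemma normal_form_tau g A : g \in unitmx -> Qmx A c \in unitmx ->
  frame A \in unitmx -> normal_form (tau g A) = normal_form A.
Proof.
move=> gU QU PU; have gPU : g *m frame A \in unitmx by rewrite unitmx_mul gU.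
rewrite !normal_formE ?frame_tau // tau_tau ?unitmx_inv //.
congr (tau _ A); apply: (can_inj (mulKmx gPU)).
by rewrite mulmxA mulmxV // mul1mx -mulmxA mulmxV // mulmx1.
Qed.

End Equivariance.

(** * Compatibility with field morphisms *)

Section Naturality.
Variables (K L : fieldType) (theta : {rmorphism K -> L}) (m : nat).
Local Notation "A ^th" := (map_mx theta A) (at level 2, format "A ^th").
Implicit Types (A : 'M[K]_(m, m * m)).

Lemma map_ntensmx p q (B : 'M[K]_(p, q)) k : (B ^t k)^th = B^th ^t k.
Proof.
case: k => [|k]; first exact: map_mx1.
by elim: k => // k IHk; rewrite !ntensmxSS map_mxT IHk.
Qed.

Lemma map_Tr1 A : (Tr1 A)^th = Tr1 A^th.
Proof.
by apply/rowP => i; rewrite !mxE rmorph_sum; apply: eq_bigr => j _; rewrite mxE.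
Qed.

Variable k : nat.

Lemma map_contraction A (c : 'I_k -> 'I_(k * 2)) :
  (contraction A c)^th = contraction A^th c.
Proof.
apply/rowP => J; rewrite !mxE rmorph_sum; apply: eq_bigr => l _.
by rewrite rmorph_prod; apply: eq_bigr => a _; rewrite mxE.
Qed.

Variables (k_gt1 : (1 < k)%N) (c : 'I_(m ^ k) -> 'I_k -> 'I_(k * 2)).

Lemma map_Qmx A : (Qmx A c)^th = Qmx A^th c.
Proof. by apply/row_matrixP => r; rewrite -map_row !rowK map_contraction. Qed.

(** The normal form is built from rational operations with coefficients in the
    prime field, hence commutes with every morphism of fields. *)
Lemma map_normal_form (s : 'I_m -> 'I_(m ^ k)) A :
  (normal_form k_gt1 c s A)^th = normal_form k_gt1 c s A^th.
Proof.
have map_frame : (frame k_gt1 c s A)^th = frame k_gt1 c s A^th.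
  rewrite /frame map_mxsub; congr (mxsub _ _ _).
  rewrite /Mmx map_mxM map_castmx map_mxT map_ntensmx map_Tr1.
  by rewrite map_invmx map_Qmx.
by rewrite /normal_form !map_mxM map_mxT map_invmx map_frame.
Qed.

End Naturality.

(** * Density of the constant matrices *)

Lemma rmorph_mmap n (R S T : comNzRingType) (f : {rmorphism R -> S})
    (theta : {rmorphism S -> T}) (h : 'I_n -> S) f' h' (p : {mpoly R[n]}) :
  theta \o f =1 f' -> theta \o h =1 h' -> theta (mmap f h p) = mmap f' h' p.
Proof.
move=> def_f' def_h'; rewrite rmorph_sum; apply: eq_bigr => mm _.
rewrite rmorphM -def_f'; congr (_ * _).
by rewrite rmorph_prod; apply: eq_bigr => i _; rewrite rmorphXn -def_h'.
Qed.

(** A parametrization of the orbit of A by polynomials in [g] and [t], free of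
    the denominator of [invmx].  Since tau (c I) A = c^-1 A, the extra scalar
    absorbs the determinants. *)
Lemma tau_adj (L : fieldType) m (A : 'M[L]_(m, m * m)) (g : 'M[L]_m) (t : L) :
    g \in unitmx -> t != 0 ->
  t *: (\adj g *m A *m (g *t g)) = tau ((t * \det g)^-1 *: invmx g) A.
Proof.
move=> gU t_n0; have d_n0 : \det g != 0 by rewrite -unitfE -unitmxE.
have s_n0 : t * \det g != 0 by rewrite mulf_neq0.
have tensZ a b (X Y : 'M[L]_m) : (a *: X) *t (b *: Y) = (a * b) *: (X *t Y).
  by apply/matrixP => i j; rewrite !mxE mulrACA.
have hU : (t * \det g)^-1 *: invmx g \in unitmx.
  by rewrite unitmxZ ?unitmx_inv // unitfE invr_eq0.
rewrite /tau invmxZ // invmxK invrK tensZ -scalemxAr -!scalemxAl scalerA.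
rewrite mulfK // /invmx gU -!scalemxAl scalerA; congr (_ *: _).
by rewrite mulfK.
Qed.

Section Density.
Variables (F : closedFieldType) (K : fieldType) (iota : {rmorphism F -> K}).

Lemma poly_neq0_on_image (q : {poly K}) :
  q != 0 -> exists a, q.[iota a] != 0.
Proof.
move=> q_n0.
have [r r_uniq r_size] : exists2 r : seq F, uniq r & size r = size q.
  elim: (size q) => [|n [r r_uniq <-]]; first by exists [::].
  have /closed_nonrootP[a] : \prod_(z <- r) ('X - z%:P) != 0.
    exact/monic_neq0/monic_prod_XsubC.
  by rewrite root_prod_XsubC => a_notin; exists (a :: r); rewrite /= ?a_notin.
have /allPn[_ /mapP[a _ ->] nroot_a] : ~~ all (root q) (map iota r).
  apply: contra q_n0 => roots_q; apply/eqP/(roots_geq_poly_eq0 roots_q).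
    by rewrite map_inj_uniq //; apply: fmorph_inj.
  by rewrite size_map r_size.
by exists a.
Qed.

(** Replace the coordinates of [w] one at a time by elements of F: as a
    polynomial in a single coordinate, [p] is nonzero, so it has finitely many
    roots, and F is infinite. *)
Lemma mpoly_neq0_on_image n (p : {mpoly K[n]}) (w : 'I_n -> K) :
  p.@[w] != 0 -> exists v : 'I_n -> F, p.@[fun i => iota (v i)] != 0.
Proof.
suff ex_v j (u : 'I_n -> K) : (j <= n)%N ->
    (forall i : 'I_n, (j <= i)%N -> exists a, u i = iota a) ->
    p.@[u] != 0 -> exists v : 'I_n -> F, p.@[fun i => iota (v i)] != 0.
  by apply: (ex_v n) => // i; rewrite leqNgt ltn_ord.
elim: j u => [|j IHj] u lt_jn in_F pu_n0.
  have /fin_all_exists[v def_v] i : exists a, u i = iota a by apply: in_F.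
  by exists v; rewrite -(meval_eq p def_v).
pose j' := Ordinal lt_jn.
pose q := mmap polyC (fun i => if i == j' then 'X else (u i)%:P) p.
have qE t : q.[t] = p.@[fun i => if i == j' then t else u i].
  rewrite /q /meval /mmap horner_sum; apply: eq_bigr => mm _.
  rewrite hornerM hornerC; congr (_ * _).
  rewrite /mmap1 horner_prod; apply: eq_bigr => i _; rewrite horner_exp.
  by case: (i == j'); rewrite ?hornerX ?hornerC.
have quE : q.[u j'] = p.@[u].
  by rewrite qE; apply: meval_eq => i; case: eqP => [->|].
have /poly_neq0_on_image[a] : q != 0.
  by apply: contraNneq pu_n0 => q0; rewrite -quE q0 horner0.
rewrite qE; apply: IHj; first exact: ltnW.
move=> i le_ji; case: eqP => [_|/eqP ne_i]; first by exists a.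
by apply: in_F; rewrite ltn_neqAle le_ji andbT eq_sym.
Qed.

(** The polynomial W in the entries of [g] and in [t] is t * det g times the
    value of [p] at the point of the orbit given by [tau_adj].  It vanishes
    where that point is undefined, so any F-point at which W is nonzero
    provides an element of GL(m, F). *)
Lemma tau_density m (p : {mpoly K[m * (m * m)]}) (A : 'M[K]_(m, m * m))
    (g : 'M[K]_m) :
  g \in unitmx -> p.@[mxvec (tau g A) 0] != 0 ->
  exists2 h : 'M[F]_m, h \in unitmx
    & p.@[mxvec (tau (map_mx iota h) A) 0] != 0.
Proof.
move=> gU pg_n0.
pose G : 'M[{mpoly K[m * m + 1]}]_m :=
  \matrix_(i, j) 'X_(lshift 1 (mxvec_index i j)).
pose t : {mpoly K[m * m + 1]} := 'X_(rshift (m * m) 0).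
pose Z := t *: (\adj G *m map_mx (@mpolyC _ K) A *m (G *t G)).
pose W := t * \det G * mmap (@mpolyC _ K) (mxvec Z 0) p.
pose evG (w : 'I_(m * m + 1) -> K) : 'M[K]_m :=
  \matrix_(i, j) w (lshift 1 (mxvec_index i j)).
pose evt (w : 'I_(m * m + 1) -> K) := w (rshift (m * m) 0).
have evW w : W.@[w] = evt w * \det (evG w) *
    p.@[mxvec (evt w *: (\adj (evG w) *m A *m (evG w *t evG w))) 0].
  have evGE : map_mx (meval w) G = evG w.
    by apply/matrixP => i j; rewrite !mxE mevalXU.
  have evtE : t.@[w] = evt w by exact: mevalXU.
  rewrite /W !rmorphM -det_map_mx evGE /= evtE; congr (_ * _).
  apply: rmorph_mmap => [a|i] /=; first exact: mevalC.
  transitivity (map_mx (meval w) (mxvec Z) 0 i); first by rewrite [RHS]mxE.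
  rewrite map_mxvec map_mxZ !map_mxM map_mx_adj map_mxT evGE /= evtE.
  by rewrite -map_mx_comp map_mx_id // => a; apply: mevalC.
pose g' := invmx g.
have g'U : g' \in unitmx by rewrite unitmx_inv.
have d_n0 : \det g' != 0 by rewrite -unitfE -unitmxE.
(* The parameters at which the orbit map of [tau_adj] takes the value
   tau g A. *)
pose w (i : 'I_(m * m + 1)) := match split i with
  | inl ij => mxvec g' 0 ij | inr _ => (\det g')^-1 end.
have wG : evG w = g'.
  by apply/matrixP => i j; rewrite mxE /w (unsplitK (inl _)) mxvecE.
have wt : evt w = (\det g')^-1 by rewrite /evt /w (unsplitK (inr _)).
have /mpoly_neq0_on_image[v] : W.@[w] != 0.
  rewrite evW wG wt mulVf // mul1r tau_adj ?invr_eq0 //.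
  by rewrite mulVf // invr1 scale1r invmxK.
rewrite evW.
pose gv : 'M[F]_m := \matrix_(i, j) v (lshift 1 (mxvec_index i j)).
pose tv := v (rshift (m * m) 0).
have -> : evG (fun i => iota (v i)) = map_mx iota gv.
  by apply/matrixP => i j; rewrite !mxE.
rewrite [evt _]/(iota tv) det_map_mx !mulf_eq0 !negb_or !fmorph_eq0.
case/andP=> /andP[tv_n0 dv_n0].
have gvU : gv \in unitmx by rewrite unitmxE unitfE.
rewrite tau_adj ?map_unitmx ?fmorph_eq0 // det_map_mx -rmorphM -fmorphV.
rewrite -map_invmx -map_mxZ => pv_n0.
exists ((tv * \det gv)^-1 *: invmx gv) => //.
by rewrite unitmxZ ?unitmx_inv // unitfE invr_eq0 mulf_neq0.
Qed.

End Density.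

(** * Substitution in rational functions *)

Lemma ratfunE (R : idomainType) (f : {fraction R}) :
  f = FracField.tofrac \n_(repr f) / FracField.tofrac \d_(repr f).
Proof.
have d_n0 : FracField.tofrac \d_(repr f) != 0.
  by rewrite tofrac_eq0 denom_ratioP.
apply: (mulIf d_n0); rewrite mulfVK //; rewrite -{1}[f]reprK.
unlock FracField.tofrac; rewrite -[LHS]FracField.pi_mul.
apply/eqmodP; rewrite /= FracField.equivfE /FracField.mulf.
rewrite !numden_Ratio ?mulf_neq0 ?oner_neq0 ?denom_ratioP //.
by rewrite !mulr1 mulrC.
Qed.

HB.instance Definition _ (F : fieldType) m :=
  GRing.RMorphism.copy (@ratC F m)
    (@FracField.tofrac {mpoly F[m * (m * m)]} \o @mpolyC _ F).

Lemma meval_map_mpoly n (R S : comNzRingType) (f : {rmorphism R -> S})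
    (w : 'I_n -> S) (p : {mpoly R[n]}) :
  (map_mpoly f p).@[w] = mmap f w p.
Proof.
by apply: rmorph_mmap => [a|i] /=; [exact: mevalC | exact: mevalXU].
Qed.

Section Substitution.
Variables (F : fieldType) (m : nat).
Local Notation tofrac := (@FracField.tofrac {mpoly F[m * (m * m)]}).
Local Notation x := (genx F m).
Local Notation C := (@ratC F m).

Definition subst_mx (B : 'M[ratfun F m]_(m, m * m))
    (p : {mpoly F[m * (m * m)]}) :=
  mmap C (mxvec B 0) p.

HB.instance Definition _ B :=
  GRing.RMorphism.copy (subst_mx B) (mmap C (mxvec B 0)).

Lemma meval_subst (B : 'M[ratfun F m]_(m, m * m)) p :
  (map_mpoly C p).@[mxvec B 0] = subst_mx B p.
Proof. exact: meval_map_mpoly. Qed.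

Lemma subst_genx p : subst_mx x p = tofrac p.
Proof.
rewrite -{2}[p]comp_mpoly_id; symmetry; apply: rmorph_mmap => i //=.
by case/mxvec_indexP: i => i j; rewrite mxvecE mxE tnth_mktuple.
Qed.

Section Extension.
Variable B : 'M[ratfun F m]_(m, m * m).
Hypothesis subst_inj : forall p : {mpoly F[m * (m * m)]},
  p != 0 -> subst_mx B p != 0.

(** [ratfun_subst] is defined on the chosen representative of a fraction; when
    no nonzero polynomial vanishes at B, any other representative gives the
    same value. *)
Lemma ratfun_subst_frac (n d : {mpoly F[m * (m * m)]}) : d != 0 ->
  ratfun_subst (tofrac n / tofrac d) B = subst_mx B n / subst_mx B d.
Proof.
move=> d_n0; set f := tofrac n / _.
have -> : ratfun_subst f B = subst_mx B \n_(repr f) / subst_mx B \d_(repr f).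
  by [].
have := ratfunE f; rewrite {1}/f => /eqP.
rewrite eqr_div ?tofrac_eq0 ?denom_ratioP // -!tofracM tofrac_eq => /eqP eq_nd.
apply/eqP; rewrite eqr_div ?subst_inj ?denom_ratioP // -!rmorphM eq_nd.
by rewrite mulrC.
Qed.

Definition subst_ext f := ratfun_subst f B.

Lemma ratfunP (f : ratfun F m) :
  exists n, exists2 d, d != 0 & f = tofrac n / tofrac d.
Proof.
exists \n_(repr f), \d_(repr f); [exact: denom_ratioP | exact: ratfunE].
Qed.

Lemma subst_ext_poly p : subst_ext (tofrac p) = subst_mx B p.
Proof.
have := @ratfun_subst_frac p 1 (oner_neq0 _).
by rewrite !rmorph1 !divr1.
Qed.

Lemma subst_ext_zmod : zmod_morphism subst_ext.
Proof.
move=> f h.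
have [n [d d_n0 ->]] := ratfunP f; have [n' [d' d'_n0 ->]] := ratfunP h.
rewrite /subst_ext -mulNr addf_div ?tofrac_eq0 // mulNr -!tofracM -tofracB.
rewrite !ratfun_subst_frac ?mulf_neq0 // -[in RHS]mulNr addf_div ?subst_inj //.
by rewrite rmorphB !rmorphM mulNr.
Qed.

Lemma subst_ext_monoid : monoid_morphism subst_ext.
Proof.
split=> [|f h]; first by rewrite -tofrac1 subst_ext_poly rmorph1.
have [n [d d_n0 ->]] := ratfunP f; have [n' [d' d'_n0 ->]] := ratfunP h.
rewrite /subst_ext mulf_div -!tofracM.
by rewrite !ratfun_subst_frac ?mulf_neq0 // !rmorphM mulf_div.
Qed.

HB.instance Definition _ :=
  GRing.isZmodMorphism.Build _ _ subst_ext subst_ext_zmod.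
HB.instance Definition _ :=
  GRing.isMonoidMorphism.Build _ _ subst_ext subst_ext_monoid.

Definition subst_rmorph : {rmorphism ratfun F m -> ratfun F m} := subst_ext.

Lemma subst_extC a : subst_ext (C a) = C a.
Proof. by rewrite subst_ext_poly /subst_mx mmapC. Qed.

Lemma subst_ext_genx : map_mx subst_ext x = B.
Proof.
apply/matrixP => i j; rewrite !mxE subst_ext_poly /subst_mx mmapX mmap1U.
by rewrite mxvecE.
Qed.

End Extension.
End Substitution.

(** Were p(tau g x) zero, p would vanish at all points tau g A with A over F,
    that is, at every point over F, as A = tau g^-1 A' is allowed. *)
Lemma subst_tau_neq0 (F : closedFieldType) m (g : 'M[F]_m)
    (p : {mpoly F[m * (m * m)]}) :
  g \in unitmx -> p != 0 ->
  subst_mx (tau (map_mx (@ratC F m) g) (genx F m)) p != 0.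
Proof.
move=> gU p_n0.
have px_n0 : (map_mpoly (@ratC F m) p).@[mxvec (genx F m) 0] != 0.
  by rewrite meval_subst subst_genx tofrac_eq0.
have [v pv_n0] := mpoly_neq0_on_image (@ratC F m) px_n0.
have {}pv_n0 : p.@[v] != 0.
  move: pv_n0; rewrite meval_map_mpoly.
  suff -> : mmap (@ratC F m) (fun i => ratC m (v i)) p = ratC m p.@[v].
    by rewrite fmorph_eq0.
  by symmetry; apply: rmorph_mmap.
(* A point at which p(tau g _) is p(v), which is nonzero. *)
pose A := tau (invmx g) (vec_mx (\row_i v i)).
have tau_A : mxvec (tau g A) 0 =1 v.
  by move=> i; rewrite tau_tau ?unitmx_inv // mulmxV // tau1 vec_mxK mxE.
pose cst := @mpolyC (m * (m * m)) F.
pose X : 'M[{mpoly F[m * (m * m)]}]_(m, m * m) :=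
  \matrix_(i, j) 'X_(mxvec_index i j).
pose B := map_mx cst g *m X *m map_mx cst (invmx g *t invmx g).
have B_tofrac : map_mx (@FracField.tofrac _) B
    = tau (map_mx (@ratC F m) g) (genx F m).
  have X_tofrac : map_mx (@FracField.tofrac _) X = genx F m.
    by apply/matrixP => a b; rewrite !mxE.
  by rewrite !map_mxM X_tofrac -!map_mx_comp /tau -map_invmx -map_mxT.
have -> : subst_mx (tau (map_mx (@ratC F m) g) (genx F m)) p
    = FracField.tofrac (mmap cst (mxvec B 0) p).
  by symmetry; apply: rmorph_mmap => // i; rewrite -B_tofrac -map_mxvec mxE.
rewrite tofrac_eq0; apply: contraNneq pv_n0 => pB0.
have B_at_A : map_mx (meval (mxvec A 0)) B = tau g A.
  have X_at_A : map_mx (meval (mxvec A 0)) X = A.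
    by apply/matrixP => a b; rewrite mxE [X a b]mxE /= mevalXU mxvecE.
  rewrite !map_mxM X_at_A -!map_mx_comp /tau.
  by rewrite !(map_mx_id (f := _ \o cst)) // => a; apply: mevalC.
rewrite -(meval_eq p tau_A) -(meval0 (mxvec A 0)) -pB0; apply/eqP; symmetry.
apply: rmorph_mmap => [a|i]; first exact: mevalC.
by rewrite -B_at_A -map_mxvec mxE.
Qed.

(** * Generated subfields *)

Section SubfieldClosure.
Variables (F : fieldType) (m : nat) (S : ratfun F m -> Prop).
Local Notation gen := (subfield_gen S).

Lemma subfield_gen0 : gen 0.
Proof. by rewrite -(rmorph0 (@ratC F m)); constructor. Qed.

Lemma subfield_gen1 : gen 1.
Proof. by rewrite -(rmorph1 (@ratC F m)); constructor. Qed.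

Lemma subfield_genD f h : gen f -> gen h -> gen (f + h).
Proof.
move=> Sf Sh; rewrite -[h]opprK -[- h]sub0r.
by do !apply: subfield_gen_sub => //; apply: subfield_gen0.
Qed.

Lemma subfield_gen_sum (I : finType) (f : I -> ratfun F m) :
  (forall i, gen (f i)) -> gen (\sum_i f i).
Proof.
move=> Sf; elim/big_ind: _ => //; first exact: subfield_gen0.
exact: subfield_genD.
Qed.

Lemma subfield_gen_mulmx p q r (A : 'M[ratfun F m]_(p, q)) (B : 'M_(q, r)) :
  (forall i j, gen (A i j)) -> (forall i j, gen (B i j)) ->
  forall i j, gen ((A *m B) i j).
Proof.
move=> SA SB i j; rewrite mxE; apply: subfield_gen_sum => a.
by apply: subfield_gen_mul.
Qed.

Lemma subfield_gen_subst (B : 'M[ratfun F m]_(m, m * m)) p :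
  (forall i j, gen (B i j)) -> gen (subst_mx B p).
Proof.
move=> SB; rewrite /subst_mx /mmap; elim/big_ind: _ => [||mm _].
- exact: subfield_gen0.
- exact: subfield_genD.
apply: subfield_gen_mul; first exact: subfield_gen_const.
rewrite /mmap1; elim/big_ind: _ => [||i _].
- exact: subfield_gen1.
- exact: subfield_gen_mul.
elim: (mm i) => [|e IHe]; first exact: subfield_gen1.
rewrite exprS; apply: subfield_gen_mul IHe.
by case/mxvec_indexP: i => a b; rewrite mxvecE.
Qed.

Lemma subfield_gen_tau (h : 'M[F]_m) (A : 'M[ratfun F m]_(m, m * m)) :
  (forall i j, gen (A i j)) ->
  forall i j, gen (tau (map_mx (@ratC F m) h) A i j).
Proof.
move=> SA; rewrite /tau -map_invmx -map_mxT.
apply: subfield_gen_mulmx => [|i j]; last first.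
  by rewrite mxE; apply: subfield_gen_const.
by apply: subfield_gen_mulmx => // i j; rewrite mxE; apply: subfield_gen_const.
Qed.

End SubfieldClosure.

Lemma subfield_gen_invariant (F : closedFieldType) m (S : ratfun F m -> Prop) :
  (forall f, S f -> GL_invariant f) ->
  forall f, subfield_gen S f -> GL_invariant f.
Proof.
move=> S_inv f Sf g gU.
pose theta := subst_rmorph (fun p => @subst_tau_neq0 F m g p gU).
rewrite -[LHS]/(theta f).
elim: Sf => [a|h /S_inv h_inv|h h' _ IHh _ IHh'|h h' _ IHh _ IHh'|h _ IHh].
- exact: (subst_extC (fun p => @subst_tau_neq0 F m g p gU)).
- exact: h_inv.
- by rewrite rmorphB IHh IHh'.
- by rewrite rmorphM IHh IHh'.
by rewrite fmorphV IHh.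
Qed.

(** * The field of invariants *)

Lemma normal_form_invariant (F : closedFieldType) (m k : nat)
    (k_gt1 : (1 < k)%N)
    (c : 'I_(m ^ k) -> 'I_k -> 'I_(k * 2)) (s : 'I_m -> 'I_(m ^ k)) :
  (forall r, injective (c r)) ->
  Qmx (genx F m) c \in unitmx -> frame k_gt1 c s (genx F m) \in unitmx ->
  forall i J, GL_invariant (normal_form k_gt1 c s (genx F m) i J).
Proof.
move=> c_inj QU PU i J g gU.
pose g_inj p := @subst_tau_neq0 F m g p gU.
transitivity
  (map_mx (subst_rmorph g_inj) (normal_form k_gt1 c s (genx F m)) i J).
  by rewrite [RHS]mxE.
rewrite map_normal_form [map_mx _ _](subst_ext_genx g_inj).
have gU' : map_mx (@ratC F m) g \in unitmx by rewrite map_unitmx.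
have nf_tau := normal_form_tau c_inj gU' QU PU.
by rewrite nf_tau.
Qed.

(** The form of [tau_density] that serves both for the zero set of a
    denominator (n = d, f = 0) and for the identity n = f d. *)
Lemma subst_tau_density (F : closedFieldType) m (f : ratfun F m)
    (n d : {mpoly F[m * (m * m)]}) (A : 'M[ratfun F m]_(m, m * m))
    (P : 'M[ratfun F m]_m) :
  P \in unitmx -> subst_mx (tau P A) n - f * subst_mx (tau P A) d != 0 ->
  exists2 h : 'M[F]_m, h \in unitmx &
    subst_mx (tau (map_mx (@ratC F m) h) A) n
      - f * subst_mx (tau (map_mx (@ratC F m) h) A) d != 0.
Proof.
pose p := map_mpoly (@ratC F m) n - f%:MP * map_mpoly (@ratC F m) d.
have pE (B : 'M[ratfun F m]_(m, m * m)) :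
    p.@[mxvec B 0] = subst_mx B n - f * subst_mx B d.
  by rewrite -!meval_subst /p mevalB mevalM mevalC.
move=> PU tauP_n0.
have p_n0 : p.@[mxvec (tau P A) 0] != 0 by rewrite pE; exact: tauP_n0.
have [h hU] := tau_density (@ratC F m) PU p_n0.
by rewrite pE => ph_n0; exists h; [exact: hU | exact: ph_n0].
Qed.

(** The denominator of f may vanish at y = tau P x, but not on its whole orbit,
    which contains x; so f is evaluated at a translate of y by a constant
    matrix, whose entries are still F-combinations of those of y. *)
Lemma invariant_in_subfield_gen (F : closedFieldType) m (P : 'M[ratfun F m]_m) :
  P \in unitmx ->
  forall f, GL_invariant f ->
  subfield_gen (fun h => exists i J, h = tau P (genx F m) i J) f.
Proof.
move=> PU f f_inv; set x := genx F m; set y := tau P x.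
have [n [d d_n0 def_f]] := ratfunP f.
have y_gen i J : subfield_gen (fun h => exists i J, h = y i J) (y i J).
  by apply: subfield_gen_mem; exists i, J.
have PVU : invmx P \in unitmx by rewrite unitmx_inv.
have [h hU dh_n0] : exists2 h : 'M[F]_m, h \in unitmx
    & subst_mx (tau (map_mx (@ratC F m) h) y) d != 0.
  (* P^-1 brings y back to the generic point x, where d does not vanish. *)
  have [|h hU dh_n0] := @subst_tau_density F m 0 d d y (invmx P) PVU.
    rewrite mul0r subr0 /y (tau_tau _ PVU PU) (mulVmx PU) tau1 subst_genx.
    by rewrite tofrac_eq0.
  by rewrite mul0r subr0 in dh_n0; exists h; [exact: hU | exact: dh_n0].
have hCU : map_mx (@ratC F m) h \in unitmx by rewrite map_unitmx.
have hPU : map_mx (@ratC F m) h *m P \in unitmx by rewrite unitmx_mul hCU PU.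
set yh := tau _ y in dh_n0.
have yhE : yh = tau (map_mx (@ratC F m) h *m P) x.
  by rewrite /yh /y (tau_tau _ hCU PU).
have f_yh : f * subst_mx yh d = subst_mx yh n.
  apply/esym/eqP; rewrite -subr_eq0 yhE; apply/negPn/negP.
  move=> /(subst_tau_density hPU)[g gU /eqP[]].
  pose g_inj q := @subst_tau_neq0 F m g q gU.
  have f_g := f_inv g gU; rewrite def_f (ratfun_subst_frac g_inj _ d_n0) in f_g.
  by rewrite def_f -f_g (mulfVK (g_inj d d_n0)) subrr.
rewrite (canRL (mulfK dh_n0) f_yh).
apply: subfield_gen_mul; first exact/subfield_gen_subst/subfield_gen_tau.
exact/subfield_gen_inv/subfield_gen_subst/subfield_gen_tau.
Qed.

Theorem theorem3p2 (F : closedFieldType) (m k : nat)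
  (m_ge1 : (1 <= m)%N) (k_ge2 : (2 <= k)%N)
  (c : 'I_(m ^ k) -> 'I_k -> 'I_(k * 2))
  (c_inj : forall r : 'I_(m ^ k), injective (c r))
  (Q_nonsing : \det (Qmx (genx F m) c) != 0)
  (s : 'I_m -> 'I_(m ^ k))
  (P_nonsing : \det (colsub s (Mmx (genx F m) k_ge2 c)) != 0) :
  let x := genx F m in
  let Pinv := colsub s (Mmx x k_ge2 c) in
  let P := invmx Pinv in
  let y := P *m x *m (Pinv *t Pinv) in
  forall f : ratfun F m,
    GL_invariant f <-> subfield_gen (fun h => exists i J, h = y i J) f.
Proof.
move=> x Pinv P y f.
have QU : Qmx x c \in unitmx by rewrite unitmxE unitfE; exact: Q_nonsing.
have PU : Pinv \in unitmx by rewrite unitmxE unitfE; exact: P_nonsing.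
have PVU : P \in unitmx by rewrite unitmx_inv; exact: PU.
have yE : y = tau P x by rewrite /tau invmxK.
split; first by rewrite yE; apply: (invariant_in_subfield_gen PVU).
apply: subfield_gen_invariant => _ [i [J ->]].
exact: (normal_form_invariant c_inj QU PU).
Qed.
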